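(* Let $V$ be a nonzero finite-dimensional real inner product space, $K\subset V$ a generating, proper, closed convex cone, and $A:V\to V$ a linear map which is quasimonotone increasing with respect to $K$. The following are equivalent: (i) $\tau(A)<0$. (ii) There exists $v\in (K^* )^\circ$ such that $A^\top v\in -(K^* )^\circ$.
   Context: $K$ is proper if $K\cap(-K)=\{0\}$ and generating if $K-K=V$. The dual cone is $K^*=\{u\in V:\langle u,x\rangle\ge 0\ \forall x\in K\}$; $(K^* )^\circ$ denotes its interior. A linear map $A:V\to V$ is quasimonotone increasing (qmi) with respect to $K$ if for all $x\in K$, $v\in K^*$ with $\langle v,x\rangle=0$ one has $\langle v,Ax\rangle\ge 0$. $A^\top$ is the adjoint of $A$ with respect to $\langle\cdot,\cdot\rangle$. $\sigma(A)\subset\mathbb C$ is the spectrum of $A$ (complex eigenvalues) and $\tau(A)=\max\{\Re(\lambda):\lambda\in\sigma(A)\}$ is the spectral bound. *)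

(* Defs.v *)
From HB Require Import structures.
From mathcomp Require Import all_boot all_order all_algebra.
From mathcomp Require Import sesquilinear complex.
From mathcomp Require Import all_classical all_reals all_analysis.
From mathcomp Require Import ring lra.

Set Implicit Arguments.
Unset Strict Implicit.
Unset Printing Implicit Defensive.

Import Order.TTheory GRing.Theory Num.Theory.
Import numFieldNormedType.Exports passmx.

Local Open Scope classical_set_scope.
Local Open Scope ring_scope.

(* A finite-dimensional real inner product space is a [V : vectType R] over
   [R : realType] together with [dot : {dot V for idfun}], a symmetric positive
   definite bilinear form.  [euclidean dot] is [V] equipped with the norm
   [Num.sqrt (dot x x)] and its topology; it is convertible to [V]. *)
Definition euclidean (R : realType) (V : vectType R)
  (dot : {dot V for idfun}) : Type := V.

Section InnerProduct.
Variables (R : realType) (V : vectType R) (dot : {dot V for idfun}).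
Implicit Types (x y z : V) (a : R).

Lemma dotC x y : dot x y = dot y x.
Proof. by rewrite [LHS]hermitian_subproof expr0 mul1r. Qed.

Lemma dotDr x y z : dot x (y + z) = dot x y + dot x z.
Proof. exact: linearDr. Qed.

Lemma dotZr a x y : dot x (a *: y) = a * dot x y.
Proof. exact: linearZr. Qed.

Lemma dot0r x : dot x 0 = 0.
Proof. by rewrite -(scale0r x) dotZr mul0r. Qed.

Lemma dot_sumr I (r : seq I) (F : I -> V) x :
  dot x (\sum_(i <- r) F i) = \sum_(i <- r) dot x (F i).
Proof. by elim/big_rec2: _ => [|i _ z _ <-]; rewrite ?dot0r ?dotDr. Qed.

Lemma dotDl x y z : dot (x + y) z = dot x z + dot y z.
Proof. by rewrite dotC dotDr !(dotC z). Qed.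

Lemma dotZl a x y : dot (a *: x) y = a * dot x y.
Proof. by rewrite dotC dotZr dotC. Qed.

Lemma dotxx_eq0 x : dot x x = 0 -> x = 0.
Proof.
by move=> x0; apply/eqP/negPn/negP => /(neq0_dnorm_gt0 (s := dot)); rewrite x0 ltxx.
Qed.

Lemma dotxx_ge0 x : 0 <= dot x x.
Proof.
have [->|/(neq0_dnorm_gt0 (s := dot))/ltW//] := eqVneq x 0.
by rewrite dot0r.
Qed.

Definition dot_norm x : R := Num.sqrt (dot x x).

Lemma dot_cauchy_schwarz x y : dot x y ^+ 2 <= dot x x * dot y y.
Proof.
have [->|y0] := eqVneq y 0.
  by rewrite !dot0r mulr0 expr0n.
have yy := neq0_dnorm_gt0 (s := dot) _ y0.
have := dotxx_ge0 (dot y y *: x + (- dot x y) *: y).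
rewrite !(dotDl, dotDr, dotZl, dotZr) (dotC y x) => h.
rewrite -subr_ge0 -(pmulr_rge0 _ yy); move: h; congr (_ <= _); ring.
Qed.

Lemma ler_dot_normD x y : dot_norm (x + y) <= dot_norm x + dot_norm y.
Proof.
rewrite -(ler_pXn2r (n := 2)) ?nnegrE ?addr_ge0 ?sqrtr_ge0//.
rewrite sqrrD !sqr_sqrtr ?dotxx_ge0// !(dotDl, dotDr) (dotC y x).
suff : dot x y <= dot_norm x * dot_norm y by lra.
apply: le_trans (ler_norm _) _.
rewrite -sqrtr_sqr -sqrtrM ?dotxx_ge0// ler_sqrt ?dot_cauchy_schwarz//.
by rewrite mulr_ge0 ?dotxx_ge0.
Qed.

Lemma dot_normZ a x : dot_norm (a *: x) = `|a| * dot_norm x.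
Proof.
by rewrite /dot_norm dotZl dotZr mulrA -expr2 sqrtrM ?sqr_ge0// sqrtr_sqr.
Qed.

Lemma dot_norm_eq0 x : dot_norm x = 0 -> x = 0.
Proof.
move=> /eqP; rewrite sqrtr_eq0 => x0; apply: dotxx_eq0.
by apply/eqP; rewrite eq_le x0 dotxx_ge0.
Qed.

End InnerProduct.

HB.instance Definition _ (R : realType) (V : vectType R)
  (dot : {dot V for idfun}) := Vector.on (euclidean dot).

HB.instance Definition _ (R : realType) (V : vectType R)
  (dot : {dot V for idfun}) :=
  Lmodule_isNormed.Build R (euclidean dot)
    (@ler_dot_normD R V dot) (@dot_normZ R V dot) (@dot_norm_eq0 R V dot).

Lemma euclidean_normE (R : realType) (V : vectType R)
  (dot : {dot V for idfun}) (x : euclidean dot) : `|x| = Num.sqrt (dot x x).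
Proof. by []. Qed.

Section Cones.
Variables (R : realType) (V : vectType R) (dot : {dot V for idfun}).
Implicit Types (K : set V) (A : 'End(V)).

Definition convex_cone K :=
  [/\ K 0, @convex_set R V K & forall (a : R) x, 0 <= a -> K x -> K (a *: x)].

Definition closed_set K := closed (K : set (euclidean dot)).

Definition interior_set K : set V := interior (K : set (euclidean dot)).

Definition proper_cone K := K `&` (-%R @` K) = [set 0].

Definition generating_cone K := [set x - y | x in K & y in K] = [set: V].

Definition dual_cone K : set V := [set u | forall x, K x -> 0 <= dot u x].

Definition qmi K A :=
  forall x v, K x -> dual_cone K v -> dot v x = 0 -> 0 <= dot v (A x).

Definition adjoint A : 'End(V) :=
  xget 0 [set B : 'End(V) | forall x y, dot (A x) y = dot x (B y)].

Lemma adjoint_ex A : exists B : 'End(V), forall x y, dot (A x) y = dot x (B y).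
Proof.
set e := vbasis {:V}; have be : basis_of {:V} e := vbasisP _.
pose G : 'M[R]_(\dim {:V}) := \matrix_(i, j) dot e`_i e`_j.
have dotE x y : dot x y = (rVof e x *m G *m (rVof e y)^T) 0 0.
  rewrite -[in LHS](rVofK be x) -[in LHS](rVofK be y) mxE /vecof.
  rewrite dot_sumr; apply: eq_bigr => j _.
  rewrite dotC dot_sumr [in RHS]mxE mulr_suml; apply: eq_bigr => i _.
  by rewrite dotZl dotZr dotC !mxE; ring.
have Gu : G \in unitmx.
  rewrite -row_free_unit -kermx_eq0; apply/eqP/row_matrixP => i.
  rewrite row0; set u := row i _.
  have uG : u *m G = 0 by apply/sub_kermxP/row_sub.
  suff : vecof e u = 0 by move=> /eqP; rewrite (vecof_eq0 be) => /eqP.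
  by apply: (@dotxx_eq0 _ _ dot); rewrite dotE (vecofK be) uG mul0mx mxE.
exists (hommx e e (invmx G *m mxof e e A *m G)^T) => x y.
rewrite !dotE (rVof_app _ be) (hommxE be be) (vecofK be) trmx_mul trmxK.
by rewrite !mulmxA mulmxK.
Qed.

Lemma adjointP A x y : dot (A x) y = dot x (adjoint A y).
Proof. exact: (xgetPex 0 (adjoint_ex A)). Qed.

Lemma adjoint_unique A (B : 'End(V)) :
  (forall x y, dot (A x) y = dot x (B y)) -> B = adjoint A.
Proof.
move=> AB; apply/lfunP => y; apply/eqP; rewrite -subr_eq0; apply/eqP.
apply: (@dotxx_eq0 _ _ dot); rewrite dotDr -scaleN1r dotZr -AB -adjointP.
by rewrite mulN1r subrr.
Qed.

End Cones.

Section Spectrum.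
Variables (R : realType) (V : vectType R).
Implicit Types (A : 'End(V)).
Local Notation e := (vbasis {:V}).

Definition spectrum A : set R[i] :=
  [set l | eigenvalue (map_mx (real_complex R) (mxof e e A)) l].

(* The eigenvalues of the complexification [V (+) iV] of [A]. *)
Lemma spectrumP A (l : R[i]) :
  spectrum A l <->
  exists x y : V, [/\ (x, y) != (0, 0),
    A x = complex.Re l *: x - complex.Im l *: y &
    A y = complex.Im l *: x + complex.Re l *: y].
Proof.
have be : basis_of {:V} e := vbasisP _.
rewrite /spectrum/=; split.
- move=> /eigenvalueP[v vA v0].
  pose rx := map_mx (@complex.Re R) v; pose ry := map_mx (@complex.Im R) v.
  have hk k : (v *m map_mx (real_complex R) (mxof e e A)) 0 k =
      ((rx *m mxof e e A) 0 k +i* (ry *m mxof e e A) 0 k)%C.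
    rewrite !mxE; apply/eqP; rewrite eq_complex /= !raddf_sum/=.
    apply/andP; split; apply/eqP; apply: eq_bigr => j _; rewrite !mxE;
      by case: (v 0 j) => a b /=; rewrite ?(mulr0, subr0, add0r, addr0).
  exists (vecof e rx), (vecof e ry); split.
  + rewrite xpair_eqE !(vecof_eq0 be); apply: contra v0 => /andP[/eqP x0 /eqP y0].
    apply/eqP/rowP => k; rewrite mxE; apply/eqP; rewrite eq_complex/=.
    by move/rowP: x0 => /(_ k); move/rowP: y0 => /(_ k); rewrite !mxE => -> ->;
      rewrite eqxx.
  + rewrite (hom_vecof _ be) -!linearZ -linearB; congr vecof.
    apply/rowP => k; move: (hk k); rewrite vA !mxE; case: (v 0 k) => a b.
    by case: (l) => c d /= [<- _].
  + rewrite (hom_vecof _ be) -!linearZ -linearD; congr vecof.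
    apply/rowP => k; move: (hk k); rewrite vA !mxE; case: (v 0 k) => a b.
    by case: (l) => c d /= [_ <-]; ring.
- move=> [x [y [xy0 Ax Ay]]]; apply/eigenvalueP.
  exists (\row_k (rVof e x 0 k +i* rVof e y 0 k)%C); last first.
    apply: contra xy0 => /eqP/rowP v0.
    rewrite xpair_eqE -!(rVof_eq0 be); apply/andP.
    by split; apply/eqP/rowP => k; move: (v0 k); rewrite !mxE => -[? ?].
  apply/rowP => k.
  have hx : (rVof e x *m mxof e e A) 0 k =
      complex.Re l * rVof e x 0 k - complex.Im l * rVof e y 0 k.
    by rewrite -(rVof_app _ be) Ax linearB !linearZ/= !mxE.
  have hy : (rVof e y *m mxof e e A) 0 k =
      complex.Im l * rVof e x 0 k + complex.Re l * rVof e y 0 k.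
    by rewrite -(rVof_app _ be) Ay linearD !linearZ/= !mxE.
  transitivity ((rVof e x *m mxof e e A) 0 k +i* (rVof e y *m mxof e e A) 0 k)%C.
    rewrite !mxE; apply/eqP; rewrite eq_complex /= !raddf_sum/=.
    apply/andP; split; apply/eqP; apply: eq_bigr => j _; rewrite !mxE /=;
      by rewrite ?(mulr0, subr0, add0r, addr0).
  rewrite hx hy !mxE; case: (l) => c d /=.
  by apply/eqP; rewrite eq_complex/=; apply/andP; split; apply/eqP; ring.
Qed.

Definition spectral_bound A : R := sup [set complex.Re l | l in spectrum A].

(* On a nonzero space the supremum is a maximum. *)
Lemma spectral_boundP A : \dim {:V} != 0%N ->
  (exists2 l, spectrum A l & complex.Re l = spectral_bound A) /\
  (forall l, spectrum A l -> complex.Re l <= spectral_bound A).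
Proof.
move=> V0; set M := map_mx (real_complex R) (mxof e e A).
have specE l : spectrum A l <-> root (char_poly M) l.
  by rewrite /spectrum/= eigenvalue_root_char.
have [s sE] : exists s, char_poly M = \prod_(z <- s) ('X - z%:P).
  have [s ->] := closed_field_poly_normal (char_poly M).
  by exists s; rewrite (monicP (char_poly_monic M)) scale1r.
have sP l : spectrum A l <-> l \in s.
  by rewrite specE sE root_prod_XsubC.
have [l0 l0s] : exists l, l \in s.
  case: s sE {sP} => [|z s _]; last by exists z; rewrite mem_head.
  move/(congr1 (size \o polyseq)); rewrite /= size_char_poly big_nil size_poly1.
  by move=> -[d0]; rewrite d0 eqxx in V0.
have [m ms mP] : exists2 m, m \in s &
    forall l, l \in s -> complex.Re l <= complex.Re m.
  elim: s l0 l0s {sE sP} => // z s IH _ _.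
  case: (s) IH => [_|z' s' IH].
    by exists z => [|l]; rewrite ?mem_head// inE => /eqP ->.
  have [m ms mP] := IH z' (mem_head _ _).
  have [zm|/ltW mz] := leP (complex.Re z) (complex.Re m).
    exists m; first by rewrite inE ms orbT.
    by move=> l; rewrite inE => /orP[/eqP -> //|/mP].
  exists z; first exact: mem_head.
  by move=> l; rewrite inE => /orP[/eqP -> //|/mP /le_trans]; apply.
have ub : ubound [set complex.Re l | l in spectrum A] (complex.Re m).
  by move=> _ [l /sP/mP lm <-].
have mem : [set complex.Re l | l in spectrum A] (complex.Re m).
  by exists m => //; apply/sP.
have boundE : spectral_bound A = complex.Re m.
  apply/eqP; rewrite eq_le ge_sup//; last by exists (complex.Re m).
  by apply: ub_le_sup => //; exists (complex.Re m).
rewrite boundE; split; first by exists m => //; apply/sP.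
by move=> l /sP/mP.
Qed.

End Spectrum.

(* Main.v *)
From HB Require Import structures.
Require Import Defs.
From mathcomp Require Import all_boot all_order all_algebra.
From mathcomp Require Import sesquilinear complex.
From mathcomp Require Import all_classical all_reals all_analysis.
From mathcomp Require Import ring lra.

(** Write B for the adjoint of A and C for the dual cone of K. Since K is closed,
    v is interior to C exactly when it is positive on K minus the origin
    ([interior_dualP]), and C has interior points because K contains no line
    ([interior_dual_exists]). Quasimonotonicity says that at a boundary point p
    of C, supported by u in K, the vector B p does not point out of C. The proof
    uses this infinitesimal form directly, without exponentials of A or a
    Perron-Frobenius eigenvector. The spectrum of A is also that of B
    ([spectrum_adjoint]).

    If v and - B v are interior to C, take an eigenvalue a + ib of B with real
    and imaginary parts x, y of an eigenvector. Among the multiples of v take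
    the smallest one such that subtracting any vector cos t x + sin t y leaves
    a point of C. One of these differences, p, is on the boundary of C; there
    the rotation by b is tangential, and quasimonotonicity forces a < 0
    ([adjoint_eigen_lt0]).

    If the spectral bound is negative, c - B is invertible for all c >= 0. Choose
    e interior to C and c1 so large that w = c1 e - B e is interior too, and
    follow v c = (c - B)^-1 w from v c1 = e down to c = 0. This path cannot leave
    C, because it cannot touch the boundary of C ([resolvent_dual]). So v 0 is
    interior to C, and B (v 0) = - w. *)

Set Implicit Arguments.
Unset Strict Implicit.
Unset Printing Implicit Defensive.

Import Order.TTheory GRing.Theory Num.Theory.
Import numFieldNormedType.Exports.

Local Open Scope classical_set_scope.
Local Open Scope ring_scope.

(** * Extrema on closed bounded sets of a Euclidean space *)

Section Euclidean.
Variables (R : realType) (V : vectType R) (dot : {dot V for idfun}).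
Implicit Types (x y z u v : V) (S : set V).
Local Notation N := (dot_norm dot).
Local Notation n := (\dim {:V}).
Local Notation e := (vbasis {:V}).

Lemma dotNr x y : dot x (- y) = - dot x y.
Proof. by rewrite -scaleN1r dotZr mulN1r. Qed.

Lemma dotBr x y z : dot x (y - z) = dot x y - dot x z.
Proof. by rewrite dotDr dotNr. Qed.

Lemma dotBl x y z : dot (x - y) z = dot x z - dot y z.
Proof. by rewrite dotC dotBr !(dotC dot z). Qed.

Lemma dotxx_gt0 x : x != 0 -> 0 < dot x x.
Proof. exact: neq0_dnorm_gt0. Qed.

Lemma dot_norm_sqr x : N x ^+ 2 = dot x x.
Proof. by rewrite sqr_sqrtr// dotxx_ge0. Qed.

Lemma dot_norm_ge0 x : 0 <= N x.
Proof. exact: sqrtr_ge0. Qed.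

Lemma dot_norm_gt0 x : x != 0 -> 0 < N x.
Proof. by move=> x0; rewrite sqrtr_gt0 dotxx_gt0. Qed.

Lemma ler_abs_dot x y : `|dot x y| <= N x * N y.
Proof.
rewrite -sqrtr_sqr -sqrtrM ?dotxx_ge0// ler_sqrt ?dot_cauchy_schwarz//.
by rewrite mulr_ge0 ?dotxx_ge0.
Qed.

(** The representing vector comes from the adjoint of the rank one map
    x |-> f x *: w: its value at w is dot w w times the vector sought. *)
Lemma dot_riesz (f : {linear V -> R^o}) : exists u, forall x, f x = dot x u.
Proof.
have [V0|[w w0]] : (forall x : V, x = 0) \/ exists w : V, w != 0.
  have [/eqP V0|V0] := boolP (\dim {:V} == 0%N).
    left=> x; apply/eqP; rewrite -memv0; have /eqP := V0.
    by rewrite dimv_eq0 => /eqP <-; rewrite memvf.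
  right; exists (vpick {:V}).
  by rewrite vpick0; apply: contra V0 => /eqP ->; rewrite dimv0.
  by exists 0 => x; rewrite (V0 x) linear0 dot0r.
have g_lin : linear (fun x => f x *: w).
  by move=> a x y; rewrite linearP scalerDl scalerA.
pose g : {linear V -> V} :=
  HB.pack (fun x => f x *: w) (GRing.isLinear.Build R V V *:%R _ g_lin).
exists ((dot w w)^-1 *: adjoint dot (linfun g) w) => x.
rewrite dotZr -adjointP lfunE/= dotZl mulrC mulfK//.
by rewrite gt_eqF// dotxx_gt0.
Qed.

(** Comparison of [dot_norm] with the coordinates of a basis: a coordinate is a
    linear form, so Riesz representation and Cauchy-Schwarz bound it. *)
Lemma coord_le_norm : exists2 M : R, 0 <= M &
  forall i x, `|coord e i x| <= M * N x.
Proof.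
have /choice[f fP] : forall i, exists u, forall x, coord e i x = dot x u.
  by move=> i; exact: dot_riesz.
exists (\sum_i N (f i)) => [|i x]; first by apply: sumr_ge0 => i _; exact: dot_norm_ge0.
rewrite fP (le_trans (ler_abs_dot _ _))// mulrC ler_wpM2r ?dot_norm_ge0//.
by rewrite (bigD1 i)//= lerDl sumr_ge0// => j _; exact: dot_norm_ge0.
Qed.

Lemma linear_le_norm (f : 'End(V)) : exists2 M : R, 0 < M &
  forall x, N (f x) <= M * N x.
Proof.
have [M M0 MP] := coord_le_norm.
have s0 : 0 <= \sum_(i < n) N (f e`_i) by apply: sumr_ge0 => i _; exact: dot_norm_ge0.
exists (M * (\sum_(i < n) N (f e`_i)) + 1) => [|x].
  by rewrite ltr_wpDl// mulr_ge0.
rewrite [X in f X](coord_vbasis (memvf x)) linear_sum/=.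
apply: (@le_trans _ _ (\sum_(i < n) N (f (coord e i x *: e`_i)))).
  elim/big_rec2: _ => [|i a b _ ab]; first by rewrite /dot_norm dot0r sqrtr0.
  by rewrite (le_trans (ler_dot_normD _ _ _))// lerD2l.
apply: (@le_trans _ _ (\sum_(i < n) M * N x * N (f e`_i))).
  by apply: ler_sum => i _; rewrite linearZ dot_normZ ler_wpM2r ?dot_norm_ge0.
rewrite -mulr_sumr mulrDl mul1r [leLHS]mulrAC lerDl; exact: dot_norm_ge0.
Qed.

Lemma interior_setP S v : interior_set dot S v <->
  exists2 r : R, 0 < r & forall x, N (x - v) < r -> S x.
Proof.
have Ndist x y : N (x - y) = N (y - x).
  by rewrite -(opprB y x) -scaleN1r dot_normZ normrN1 mul1r.
rewrite /interior_set /interior; split.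
  move=> /nbhs_normP[r r0 rS]; exists r => // x xv; apply: rS.
  by rewrite Ndist in xv.
move=> [r r0 rS]; apply/nbhs_normP; exists r => // x xv; apply: rS.
by rewrite Ndist.
Qed.

Lemma dot_continuous v : continuous (dot v : euclidean dot -> R).
Proof.
move=> x; apply/(@cvgrPdist_lt R R^o _ (nbhs (x : euclidean dot))) => d d0.
apply/nbhs_normP.
have c0 : 0 < N v + 1 by rewrite ltr_wpDl// dot_norm_ge0.
exists (d / (N v + 1)); rewrite /= ?divr_gt0// => y xy.
have {}xy : N (x - y) * (N v + 1) < d by rewrite -ltr_pdivlMr.
rewrite -dotBr (le_lt_trans (ler_abs_dot _ _))// (le_lt_trans _ xy)//.
by rewrite mulrC ler_wpM2l ?dot_norm_ge0// lerDl.
Qed.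

(** Coordinates carry the problem to row vectors, where closed bounded sets are
    compact; boundedness is transported by [coord_le_norm], closedness by the
    continuity of the inverse [phi] of the coordinate map. *)
Lemma closed_bounded_min S (f : V -> R) : closed_set dot S ->
  (exists M, forall x, S x -> N x <= M) -> S !=set0 ->
  continuous (f : euclidean dot -> R) ->
  exists2 x, S x & forall y, S y -> f x <= f y.
Proof.
move=> Scl [B SB] [s Ss] fc.
pose phi (x : 'rV[R]_n) : euclidean dot := \sum_(i < n) x 0 i *: (e`_i : euclidean dot).
have phic : continuous phi.
  apply: continuous_big => [|i _ x]; first exact: add_continuous.
  have xc := @coord_continuous R 1 n 0 i x.
  exact: (@cvgZr_tmp R (euclidean dot) _ (nbhs x) _
    (fun y : 'rV[R]_n => y 0 i) (x 0 i) e`_i xc).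
pose psi (x : V) : 'rV[R]_n := \row_i coord e i x.
have psiK x : phi (psi x) = x.
  rewrite [RHS](coord_vbasis (memvf x)); apply: eq_bigr => i _.
  by rewrite mxE.
have phiK (x : 'rV[R]_n) : psi (phi x) = x.
  apply/rowP => i; rewrite mxE coord_sum_free//.
  exact: (basis_free (vbasisP _)).
have Tc : compact (phi @^-1` S).
  apply: bounded_closed_compact; last first.
    by apply: preimage_closed => // x _; exact: phic.
  have [M M0 MP] := coord_le_norm.
  exists (M * `|B|); split; first exact: num_real.
  move=> c /ltW cM x /SB xB; apply: le_trans cM.
  have B0 : 0 <= B by rewrite (le_trans _ xB)// dot_norm_ge0.
  rewrite ger0_norm// [leLHS]mx_normrE; apply/bigmax_leP; split => /= [|[i j] _].
    by rewrite mulr_ge0.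
  rewrite ord1 -[x]phiK mxE (le_trans (MP _ _))//= ler_wpM2l//.
have T0 : phi @^-1` S !=set0 by exists (psi s); rewrite /= psiK.
have [|x xS xP] := @EVT_min_rV R _ (f \o phi) (phi @^-1` S) T0 Tc.
  apply: continuous_subspaceT => x; apply: continuous_comp; first exact: phic.
  exact: fc.
exists (phi x) => [|y Sy]; first exact: set_mem xS.
by have := xP (psi y); rewrite /= psiK; apply; apply/mem_set; rewrite /= psiK.
Qed.

End Euclidean.

(** * The interior of the dual cone *)

Section Cones.
Variables (R : realType) (V : vectType R) (dot : {dot V for idfun}).
Implicit Types (x y z u v : V) (K : set V).
Local Notation N := (dot_norm dot).

Lemma convex_coneD K x y : convex_cone K -> K x -> K y -> K (x + y).
Proof.
move=> [_ Kconv Kscale] Kx Ky.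
(* x + y is twice the midpoint of x and y. *)
have ge0 : 0 <= 2^-1 :> R by rewrite invr_ge0.
have le1 : 2^-1 <= 1 :> R by rewrite invf_le1// ler1n.
have := Kconv x y (Itv01 ge0 le1) (mem_set Kx) (mem_set Ky).
move=> /set_mem/(Kscale 2 _ (ler0n _ _)); congr K.
rewrite /conv/= -[2^-1 *: x + _]/(2^-1 *: x + (1 - 2^-1) *: y).
rewrite scalerDr !scalerA mulrBr mulfV ?pnatr_eq0// mulr1 scale1r.
by rewrite -[2]/(1 + 1) addrK scale1r.
Qed.

(** By homogeneity the constant is the minimum of [dot v] over the unit vectors
    of [K]. *)
Lemma cone_coercive K v : convex_cone K -> closed_set dot K ->
  (forall u, K u -> u != 0 -> 0 < dot v u) ->
  exists2 m : R, 0 < m & forall u, K u -> m * N u <= dot v u.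
Proof.
move=> [_ _ KZ] Kcl vpos.
pose S := K `&` [set u | N u = 1].
have SZ u : K u -> u != 0 -> S ((N u)^-1 *: u).
  move=> Ku u0; split => /=; first by apply: KZ => //; rewrite invr_ge0 dot_norm_ge0.
  by rewrite dot_normZ ger0_norm ?invr_ge0 ?dot_norm_ge0// mulVf ?gt_eqF ?dot_norm_gt0.
have [S0|/set0P S0] := eqVneq S set0.
  exists 1 => // u Ku; have [->|u0] := eqVneq u 0.
    by rewrite /dot_norm !dot0r sqrtr0 mulr0.
  by have := SZ u Ku u0; rewrite S0.
have Scl : closed_set dot S.
  apply: closedI => //.
  apply: (@preimage_closed (euclidean dot) R (fun u => N u) [set 1]) => [u _|].
    exact: (@norm_continuous _ (euclidean dot)).
  exact: closed_eq.
have Sb : exists M, forall u, S u -> N u <= M by exists 1 => u [_ ->].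
have [u [Ku u1] uP] := closed_bounded_min Scl Sb S0 (@dot_continuous _ _ dot v).
have u0 : u != 0.
  by apply: contra_eq_neq u1 => ->; rewrite /dot_norm dot0r sqrtr0 eq_sym oner_eq0.
exists (dot v u) => [|w Kw]; first exact: vpos.
have [->|w0] := eqVneq w 0; first by rewrite /dot_norm !dot0r sqrtr0 mulr0.
have := uP _ (SZ w Kw w0); rewrite dotZr mulrC ler_pdivlMr ?dot_norm_gt0//.
Qed.

(** An interior point survives the perturbation by a small negative multiple of
    u, which gives strict positivity at u; conversely strict positivity is
    uniform by [cone_coercive], so it survives small perturbations of v. *)
Lemma interior_dualP K v : convex_cone K -> closed_set dot K ->
  interior_set dot (dual_cone dot K) v <->
  forall u, K u -> u != 0 -> 0 < dot v u.
Proof.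
move=> Kcone Kcl; rewrite interior_setP; split.
  move=> [r r0 rP] u Ku u0; have Nu0 := dot_norm_gt0 dot u0.
  have t0 : 0 < r / 2 / N u by rewrite !divr_gt0.
  have : dual_cone dot K (v - (r / 2 / N u) *: u).
    apply: rP; rewrite addrAC subrr add0r -scaleNr dot_normZ normrN gtr0_norm//.
    by rewrite divfK ?gt_eqF// ltr_pdivrMr// ltr_pMr// ltr1n.
  move=> /(_ u Ku); rewrite dotBl dotZl subr_ge0; apply: lt_le_trans.
  by rewrite mulr_gt0// dotxx_gt0.
move=> /(cone_coercive Kcone Kcl)[m m0 mP]; exists m => // x xv u Ku.
have := ler_abs_dot dot (x - v) u; rewrite dotBl ler_norml => /andP[h _].
have := ler_wpM2r (dot_norm_ge0 dot u) (ltW xv); have := mP u Ku; lra.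
Qed.

Lemma proper_coneP K u : proper_cone K -> K u -> K (- u) -> u = 0.
Proof.
move=> Kpr Ku KNu; have : (K `&` -%R @` K) u.
  by split => //; exists (- u) => //; rewrite opprK.
by rewrite Kpr.
Qed.

(** Let p be the point of [K] nearest to - u. The variational inequality says
    that w = p + u is in the dual cone and that dot w p <= 0, so
    dot w u >= dot w w; and w = 0 would put - u in [K]. *)
Lemma dual_separation K u : convex_cone K -> closed_set dot K -> proper_cone K ->
  K u -> u != 0 -> exists2 w, dual_cone dot K w & 0 < dot w u.
Proof.
move=> Kcone Kcl Kpr Ku u0; have [K0 _ KZ] := Kcone.
pose f k := N (k + u).
have fc : continuous (f : euclidean dot -> R).
  move=> k; apply: (@cvg_norm _ (euclidean dot) _ (nbhs (k : euclidean dot))).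
  exact: (@cvgD _ (euclidean dot) _ (nbhs (k : euclidean dot)) _ idfun
    (fun=> u) k u cvg_id (cvg_cst _)).
pose S := K `&` [set k | f k <= N u].
have Scl : closed_set dot S.
  apply: closedI => //.
  apply: (@preimage_closed (euclidean dot) R f [set x | x <= N u]) => [k _|].
    exact: fc.
  exact: closed_le.
have Sb : exists M, forall k, S k -> N k <= M.
  exists (N u + N u) => k [_ /= fk].
  rewrite -[k](addrK u) (le_trans (ler_dot_normD _ _ _))// lerD//.
  by rewrite -scaleN1r dot_normZ normrN1 mul1r.
have S0 : S 0 by split => //=; rewrite /f add0r.
have [p [Kp pu] pmin] := closed_bounded_min Scl Sb (ex_intro _ _ S0) fc.
have {}pmin k : K k -> dot (p + u) (p + u) <= dot (k + u) (k + u).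
  move=> Kk; rewrite -!dot_norm_sqr ler_pXn2r ?nnegrE ?dot_norm_ge0//.
  have [|/ltW] := leP (f k) (N u); first by move=> fk; apply: pmin.
  exact: le_trans.
have [w wE] : exists w, w = p + u by exists (p + u).
rewrite -wE in pmin.
(* [var] is minimality at p along the direction k. *)
have var k t : K (p + t *: k) -> 0 <= 2 * t * dot w k + t ^+ 2 * dot k k.
  move=> /pmin; rewrite addrAC -wE !(dotDl, dotDr, dotZl, dotZr) (dotC dot k w).
  by rewrite -subr_ge0; congr (_ <= _); ring.
have wK k : K k -> 0 <= dot w k.
  move=> Kk; rewrite leNgt; apply/negP => wk.
  have d0 := dotxx_ge0 dot k.
  (* Adding 1 keeps the denominator nonzero; the first order term still wins. *)
  set t := - dot w k / (dot k k + 1).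
  have c0 : 0 < dot k k + 1 by rewrite ltr_wpDl.
  have t0 : 0 < t by rewrite divr_gt0// oppr_gt0.
  have tE : t * dot k k = - dot w k - t.
    by rewrite -[- dot w k](divfK (lt0r_neq0 c0)) -/t; ring.
  have := var k _ (convex_coneD Kcone Kp (KZ _ _ (ltW t0) Kk)).
  have -> : 2 * t * dot w k + t ^+ 2 * dot k k = t * (2 * dot w k + t * dot k k).
    by ring.
  by rewrite pmulr_rge0// tE; lra.
have wp : dot w p <= 0.
  rewrite leNgt; apply/negP => wp.
  have d0 := dotxx_ge0 dot p.
  (* This step is at most 1, hence stays on the ray through p. *)
  set t := dot w p / (dot w p + dot p p).
  have c0 : 0 < dot w p + dot p p by rewrite ltr_pwDl.
  have t0 : 0 < t by rewrite divr_gt0.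
  have t1 : t <= 1 by rewrite ler_pdivrMr// mul1r lerDl.
  have Kt : K (p + (- t) *: p).
    by rewrite -{1}[p]scale1r -scalerDl; apply: KZ => //; rewrite subr_ge0.
  have tE : t * (dot w p + dot p p) = dot w p by rewrite divfK// gt_eqF.
  have := var p _ Kt; nra.
have w0 : w != 0.
  apply: contra u0 => /eqP w0; apply/eqP/(proper_coneP Kpr Ku).
  by rewrite (_ : - u = p)//; apply/esym/eqP; rewrite -addr_eq0 -wE w0.
exists w => //.
have : 0 < dot w w by exact: dotxx_gt0.
rewrite {2}wE dotDr; lra.
Qed.

(** Separating functionals are added one at a time: if u in [K] lies in the
    subspace [U] and w is positive at u, what remains is to be positive on the
    part of [K] where w vanishes, which lies in a smaller subspace of [U]. *)
Lemma interior_dual_exists K : convex_cone K -> closed_set dot K ->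
  proper_cone K -> exists w, interior_set dot (dual_cone dot K) w.
Proof.
move=> Kcone Kcl Kpr.
suff H n (U : {vspace V}) : (\dim U <= n)%N -> exists2 w, dual_cone dot K w &
    forall u, K u -> u \in U -> u != 0 -> 0 < dot w u.
  have [w _ wP] := H _ fullv (leqnn _).
  by exists w; apply/interior_dualP => // u Ku; apply: wP => //; rewrite memvf.
elim: n U => [|n IH] U dU.
  exists 0 => [u _|u _]; first by rewrite dotC dot0r.
  move: dU; rewrite leqn0 dimv_eq0 => /eqP ->.
  by rewrite memv0 => ->.
have [[u [Ku Uu u0]]|noU] := pselect (exists u, [/\ K u, u \in U & u != 0]); last first.
  exists 0 => [u _|u Ku Uu u0]; first by rewrite dotC dot0r.
  by exfalso; apply: noU; exists u.
have [w Kw wu] := dual_separation Kcone Kcl Kpr Ku u0.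
have w_lin : linear (dot w : V -> R^o) by move=> a x y; rewrite dotDr dotZr.
pose g : {linear V -> R^o} :=
  HB.pack (dot w : V -> R^o) (GRing.isLinear.Build R V R^o *:%R _ w_lin).
pose U' := (U :&: lker (linfun g))%VS.
have U'P z : (z \in U') = (z \in U) && (dot w z == 0).
  by rewrite memv_cap memv_ker lfunE.
have [|w' Kw' w'P] := IH U'.
  rewrite -ltnS (leq_trans _ dU)// ltn_neqAle dimvS ?capvSl// andbT.
  apply/negP => dE; have : U' == U by rewrite eqEdim capvSl (eqP dE) leqnn.
  by move=> /eqP E; move: Uu; rewrite -E U'P (gt_eqF wu) andbF.
exists (w + w') => [z Kz|z Kz Uz z0]; rewrite dotDl.
  by rewrite addr_ge0 ?Kw ?Kw'.
have := Kw z Kz; rewrite le_eqVlt => /orP[/eqP wz|wz].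
  by rewrite -wz add0r w'P// U'P Uz -wz eqxx.
by rewrite ltr_pwDl// Kw'.
Qed.

End Cones.

(** * Quasimonotone maps and their spectrum *)

Section Adjoint.
Variables (R : realType) (V : vectType R) (dot : {dot V for idfun}).
Implicit Types (x y z u v w : V) (K : set V) (A B : 'End(V)).
Local Notation N := (dot_norm dot).

(** If [B] were injective it would be onto; writing x = B t would give
    dot x x = dot (A x) t = 0. *)
Lemma adjoint_kernel A B x : (forall y z, dot (A y) z = dot y (B z)) ->
  x != 0 -> A x = 0 -> exists2 z, z != 0 & B z = 0.
Proof.
move=> AB x0 Ax0; have [kB|kB] := eqVneq (lker B) 0%VS; last first.
  exists (vpick (lker B)); first by rewrite vpick0.
  by apply/eqP; rewrite -memv_ker memv_pick.
have := dotxx_gt0 dot x0.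
rewrite -[X in dot _ X](lker0_lfunVK (f := B)) ?kB// -AB Ax0.
by rewrite dotC dot0r ltxx.
Qed.

(** The number a + ib is an eigenvalue of [A] exactly when the real operator
    (A - a)^2 + b^2 is singular, and singularity passes to the adjoint by
    [adjoint_kernel]. This avoids complexifying the inner product. *)
Lemma spectrum_adjoint A B (l : R[i]) :
  (forall y z, dot (A y) z = dot y (B z)) -> spectrum A l -> spectrum B l.
Proof.
move=> AB /spectrumP[x [y [xy0 Ax Ay]]]; apply/spectrumP.
move: (complex.Re l) (complex.Im l) Ax Ay => a b Ax Ay.
pose D C : 'End(V) := (C - a *: \1)%VF.
have DE C z : D C z = C z - a *: z.
  by rewrite /D add_lfunE opp_lfunE scale_lfunE id_lfunE.
pose Q C : 'End(V) := (D C \o D C + b ^+ 2 *: \1)%VF.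
have QE C z : Q C z = D C (D C z) + b ^+ 2 *: z.
  by rewrite /Q add_lfunE comp_lfunE scale_lfunE id_lfunE.
have DAB z t : dot (D A z) t = dot z (D B t).
  by rewrite !DE dotBl dotBr dotZl dotZr AB.
have QAB z t : dot (Q A z) t = dot z (Q B t).
  by rewrite !QE dotDl dotDr dotZl dotZr !DAB.
have DAx : D A x = - (b *: y) by rewrite DE Ax addrAC subrr add0r.
have DAy : D A y = b *: x by rewrite DE Ay addrK.
have QAx : Q A x = 0.
  by rewrite QE DAx linearN linearZ/= DAy scalerA -expr2 addNr.
have QAy : Q A y = 0.
  by rewrite QE DAy linearZ/= DAx scalerN scalerA -expr2 addNr.
have [z z0] : exists2 z, z != 0 & Q B z = 0.
  have [x0|x0] := eqVneq x 0.
    apply: (adjoint_kernel QAB _ QAy).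
    by apply: contra xy0 => /eqP ->; rewrite x0.
  exact: (adjoint_kernel QAB x0 QAx).
rewrite QE => /eqP; rewrite addr_eq0 => /eqP DDz.
have BE t : B t = a *: t + D B t by rewrite DE addrC subrK.
have pair0 t t' : t != 0 -> (t, t') != (0, 0) :> V * V.
  by apply: contra => /eqP[-> _].
(* For b != 0 the vector z determines its partner. For b = 0 the operator is
   the square of B - a, and either z or its image under B - a is a real
   eigenvector. *)
have [b0|b0] := eqVneq b 0; last first.
  exists z, (- (b^-1 *: D B z)); split; first exact: pair0.
    by rewrite BE scalerN scalerA mulfV// scale1r opprK.
  rewrite BE addrC linearN linearZ/= DDz scalerN opprK scalerA; congr (_ *: _ + _).
  by rewrite expr2 mulKf.
rewrite b0 in DDz *; rewrite expr0n/= scale0r oppr0 in DDz.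
have real0 t : t != 0 -> D B t = 0 -> exists x0 y0, [/\ (x0, y0) != (0, 0),
    B x0 = a *: x0 - 0 *: y0 & B y0 = 0 *: x0 + a *: y0].
  move=> t0 Dt; exists t, 0; split; first exact: pair0.
    by rewrite BE Dt scaler0 subr0 addr0.
  by rewrite linear0 scale0r scaler0 addr0.
have [Dz|Dz] := eqVneq (D B z) 0; first exact: real0 z0 Dz.
exact: real0 Dz DDz.
Qed.

(** On x and y the map [B] is a plus b times the quarter turn x -> - y,
    y -> x. Let u maximise F u = (dot x u)^2 + (dot y u)^2 over the compact
    base dot v u = 1 of [K], and set p = F u v - (dot x u) x - (dot y u) y. By
    Cauchy-Schwarz p is in the dual cone, and it vanishes at u. The quarter
    turn contributes nothing at u, so quasimonotonicity, 0 <= dot (B p) u, reads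
    0 <= F u (dot (B v) u - a), while dot (B v) u < 0. *)
Lemma adjoint_eigen_lt0 K A B v x y (a b : R) :
  convex_cone K -> closed_set dot K -> generating_cone K -> qmi dot K A ->
  (forall y z, dot (A y) z = dot y (B z)) ->
  (forall u, K u -> u != 0 -> 0 < dot v u) ->
  (forall u, K u -> u != 0 -> dot (B v) u < 0) ->
  (x, y) != (0, 0) -> B x = a *: x - b *: y -> B y = b *: x + a *: y -> a < 0.
Proof.
move=> Kcone Kcl Kgen Aqmi AB vpos Bvneg xy0 Bx By.
have [K0 _ KZ] := Kcone.
pose S := K `&` [set u | dot v u = 1].
pose F u := dot x u ^+ 2 + dot y u ^+ 2.
have Fge0 u : 0 <= F u by rewrite addr_ge0 ?sqr_ge0.
have S_normalize u : K u -> u != 0 -> S ((dot v u)^-1 *: u).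
  move=> Ku u0; have vu := vpos u Ku u0; split => /=.
    by apply: KZ => //; rewrite invr_ge0 ltW.
  by rewrite dotZr mulVf// gt_eqF.
have FZ t u : F (t *: u) = t ^+ 2 * F u by rewrite /F !dotZr; ring.
have Sneq0 u : S u -> u != 0.
  by move=> [_ /= vu]; apply: contra_eq_neq vu => ->; rewrite dot0r eq_sym oner_eq0.
(* [F] cannot vanish on [K], which spans the space. *)
have [s Ss Fs] : exists2 s, S s & 0 < F s.
  have [[u Ku Fu]|noF] := pselect (exists2 u, K u & F u != 0).
    have u0 : u != 0.
      by apply: contra Fu => /eqP ->; rewrite /F !dot0r expr0n addr0.
    exists ((dot v u)^-1 *: u); first exact: S_normalize.
    rewrite FZ mulr_gt0 ?exprn_gt0 ?invr_gt0 ?vpos// lt_neqAle eq_sym Fu/=.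
    exact: Fge0.
  exfalso; move/negP: xy0; apply.
  have FK u : K u -> dot x u = 0 /\ dot y u = 0.
    move=> Ku; have : F u == 0 by apply/negPn/negP => Fu; apply: noF; exists u.
    by rewrite paddr_eq0 ?sqr_ge0// !sqrf_eq0 => /andP[/eqP ? /eqP].
  have dec z : exists p q, [/\ K p, K q & z = p - q].
    have : [set: V] z by [].
    by rewrite -Kgen => -[p Kp [q Kq <-]]; exists p, q.
  have [p [q [/FK[xp _] /FK[xq _] xE]]] := dec x.
  have [p' [q' [/FK[_ yp] /FK[_ yq] yE]]] := dec y.
  have -> : x = 0 by apply: (@dotxx_eq0 _ _ dot); rewrite {2}xE dotBr xp xq subrr.
  by have -> : y = 0 by apply: (@dotxx_eq0 _ _ dot); rewrite {2}yE dotBr yp yq subrr.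
have Scl : closed_set dot S.
  apply: closedI => //.
  apply: (@preimage_closed (euclidean dot) R (dot v) [set 1]) => [u _|].
    exact: dot_continuous.
  exact: closed_eq.
have Sb : exists M, forall u, S u -> N u <= M.
  have [m m0 mP] := cone_coercive Kcone Kcl vpos.
  by exists (1 / m) => u [Ku /= vu]; rewrite ler_pdivlMr// mulrC -vu mP.
have Fc : continuous ((fun u => - F u) : euclidean dot -> R).
  move=> u; have xc := @dot_continuous _ _ dot x u.
  have yc := @dot_continuous _ _ dot y u.
  exact: (cvgN (cvgD (cvgM xc xc) (cvgM yc yc))).
have [u Su umax] := closed_bounded_min Scl Sb (ex_intro _ s Ss) Fc.
have [Ku /= vu] := Su.
have Fu : 0 < F u by rewrite (lt_le_trans Fs)// -lerN2 umax.
set p := F u *: v - (dot x u *: x + dot y u *: y).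
have pE z : dot p z = F u * dot v z - (dot x u * dot x z + dot y u * dot y z).
  by rewrite /p dotBl dotDl !dotZl.
have pS z : S z -> 0 <= dot p z.
  move=> Sz; have [_ /= vz] := Sz; have := umax z Sz.
  rewrite pE vz /F lerN2.
  have := sqr_ge0 (dot x u - dot x z); have := sqr_ge0 (dot y u - dot y z).
  rewrite !sqrrB; lra.
have pK : dual_cone dot K p.
  move=> z Kz; have [->|z0] := eqVneq z 0; first by rewrite dot0r.
  have := pS _ (S_normalize z Kz z0).
  by rewrite dotZr pmulr_rge0// invr_gt0 vpos.
have pu : dot p u = 0 by rewrite pE vu /F; ring.
have := Aqmi u p Ku pK pu.
rewrite dotC AB dotC /p linearB linearD !linearZ/= Bx By.
rewrite dotBl dotDl !dotZl dotBl dotDl !dotZl.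
have := Bvneg u Ku (Sneq0 u Su); move: Fu; rewrite /F.
move: (dot x u) (dot y u) (dot (B v) u) => al be ga Fpos ga0 h.
have : 0 <= (al ^+ 2 + be ^+ 2) * (ga - a) by move: h; congr (_ <= _); ring.
rewrite pmulr_rge0//; lra.
Qed.

(** With T the inverse of c0 - B, one has v c - v c0 = (c0 - c) T (v c). The
    radius makes |c - c0| times the bound of T at most 1/2, which absorbs the
    unknown v c on the right. *)
Lemma resolvent_continuous B w (v : R -> V) (c0 r : R) :
  lker (c0 *: \1 - B)%VF == 0%VS ->
  (forall c, 0 <= c -> c *: v c - B (v c) = w) -> 0 <= c0 -> 0 < r ->
  exists2 d, 0 < d & forall c, 0 <= c -> `|c - c0| < d -> N (v c - v c0) < r.
Proof.
move=> kerB vE c00 r0.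
pose T := ((c0 *: \1 - B)^-1)%VF.
have [M M0 MP] := linear_le_norm dot T.
have n0 := dot_norm_ge0 dot (v c0); have n1 : 0 < 2 * (N (v c0) + 1) by lra.
exists (Num.min 2^-1 (r / (2 * (N (v c0) + 1))) / M) => [|c cge0 cd].
  by rewrite divr_gt0// lt_min invr_gt0 ltr0n divr_gt0.
have vc : v c - v c0 = T ((c0 - c) *: v c).
  rewrite -[LHS](lker0_lfunK kerB); congr (T _).
  rewrite linearB/= !(add_lfunE, opp_lfunE, scale_lfunE, id_lfunE) vE//.
  by rewrite -(vE c cge0) scalerBl opprB addrA subrK.
have le1 : N (v c - v c0) <= M * `|c - c0| * N (v c).
  by rewrite vc (le_trans (MP _))// dot_normZ distrC mulrA.
have le2 : N (v c) <= N (v c - v c0) + N (v c0).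
  by rewrite -{1}[v c](subrK (v c0)) ler_dot_normD.
move: cd; rewrite ltr_pdivlMr// [_ * M]mulrC lt_min => /andP[q1 q2].
rewrite ltr_pdivlMr// in q2.
have q0 : 0 <= M * `|c - c0| by rewrite mulr_ge0// ltW.
have D0 := dot_norm_ge0 dot (v c - v c0).
move: (M * _) (N (v c - v c0)) (N (v c)) (N (v c0)) le1 le2 q0 q1 q2 n0 D0 {n1} =>
  q D n n' le1 le2 q0 q1 q2 n0 D0.
have : q * n <= q * (D + n') by rewrite ler_wpM2l.
have : q * D <= 2^-1 * D by rewrite ler_wpM2r// ltW.
lra.
Qed.

(** The boundary of the dual cone is out of reach for the resolvent: if
    dot v u = 0, quasimonotonicity gives dot (B v) u >= 0, against
    dot (c v - B v) u > 0. *)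
Lemma resolvent_dual_pos K A B c v : qmi dot K A ->
  (forall y z, dot (A y) z = dot y (B z)) ->
  (forall u, K u -> u != 0 -> 0 < dot (c *: v - B v) u) ->
  dual_cone dot K v -> forall u, K u -> u != 0 -> 0 < dot v u.
Proof.
move=> Aqmi AB wpos vK u Ku u0.
have := vK u Ku; rewrite le_eqVlt => /orP[/eqP vu|//].
have := Aqmi u v Ku vK (esym vu); rewrite dotC AB dotC.
have := wpos u Ku u0; rewrite dotBl dotZl -vu; lra.
Qed.

(** The parameters c at which v c is in the dual cone form a set which is closed
    in [0, c1] because the dual cone is closed, and open by [resolvent_dual_pos]
    because v c is then interior. It contains c1, so it contains 0; the proof
    examines the supremum s of the parameters that fail. *)
Lemma resolvent_dual K A B w (v : R -> V) c1 :
  convex_cone K -> closed_set dot K -> qmi dot K A ->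
  (forall y z, dot (A y) z = dot y (B z)) ->
  (forall c, 0 <= c -> lker (c *: \1 - B)%VF == 0%VS) ->
  (forall c, 0 <= c -> c *: v c - B (v c) = w) ->
  (forall u, K u -> u != 0 -> 0 < dot w u) ->
  0 <= c1 -> dual_cone dot K (v c1) -> dual_cone dot K (v 0).
Proof.
move=> Kcone Kcl Aqmi AB kerB vE wpos c10 vc1.
have inside c : 0 <= c -> dual_cone dot K (v c) ->
    forall u, K u -> u != 0 -> 0 < dot (v c) u.
  by move=> c0; apply: (resolvent_dual_pos Aqmi AB (c := c)); rewrite vE.
have near_v c r (c0 : 0 <= c) := resolvent_continuous (r := r) (kerB c c0) vE c0.
apply: contrapT => v0.
pose S := [set c | 0 <= c <= c1 /\ ~ dual_cone dot K (v c)].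
have S0 : S 0 by split => //; rewrite lexx.
have Sub : ubound S c1 by move=> c [/andP[]].
have Ssup : has_sup S by split; [exists 0|exists c1].
set s := sup S.
have s0 : 0 <= s by apply: ub_le_sup => //; exists c1.
have s1 : s <= c1 by apply: ge_sup => //; exists 0.
have [vs|vs] := pselect (dual_cone dot K (v s)).
  have /(interior_dualP _ Kcone Kcl)/interior_setP[r r0 rP] := inside s s0 vs.
  have [d d0 dP] := near_v s r s0 r0.
  have [c Sc] := sup_adherent d0 Ssup; rewrite -/s => sdc.
  have [/andP[cge0 _] vc] := Sc.
  have cs : c <= s by apply: ub_le_sup => //; exists c1.
  by apply: vc; apply/rP/dP => //; rewrite ler0_norm ?subr_le0//; lra.
have [u [Ku vu]] : exists u, K u /\ dot (v s) u < 0.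
  apply: contrapT => nou; apply: vs => u Ku; rewrite leNgt; apply/negP => vu.
  by apply: nou; exists u.
have u0 : u != 0 by apply: contraTneq vu => ->; rewrite dot0r ltxx.
have Nu0 := dot_norm_gt0 dot u0.
have r0 : 0 < - dot (v s) u / N u by rewrite divr_gt0// oppr_gt0.
have [d d0 dP] := near_v s _ s0 r0.
have sc1 : s < c1.
  by rewrite lt_neqAle s1 andbT; apply/eqP => E; apply: vs; rewrite E.
pose c := Num.min (s + d / 2) c1.
have sc : s < c by rewrite lt_min sc1 andbT ltrDl divr_gt0.
have cs : c <= s + d / 2 by rewrite ge_min lexx.
have Sc : S c.
  split=> [|vc]; first by rewrite (le_trans s0 (ltW sc)) ge_min lexx orbT.
  have : N (v c - v s) < - dot (v s) u / N u.
    by apply: dP; [exact: le_trans s0 (ltW sc)|rewrite gtr0_norm ?subr_gt0//; lra].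
  rewrite ltr_pdivlMr//; have := ler_abs_dot dot (v c - v s) u.
  by rewrite dotBl => /(le_trans (ler_norm _)); have := vc u Ku; lra.
have : c <= s by apply: ub_le_sup => //; exists c1.
by rewrite leNgt sc.
Qed.

Lemma spectral_bound_resolvent_ker A (c : R) : \dim {:V} != 0%N ->
  spectral_bound A < c -> lker (c *: \1 - A)%VF == 0%VS.
Proof.
move=> V0 Ac; have [_ bound] := spectral_boundP A V0.
apply/negPn/negP => ker0.
have z0 : vpick (lker (c *: \1 - A)%VF) != 0 by rewrite vpick0.
have /esym := memv_pick (lker (c *: \1 - A)%VF).
move: z0; set z := vpick _ => z0; rewrite memv_ker => /esym.
rewrite !(add_lfunE, opp_lfunE, scale_lfunE, id_lfunE) subr_eq0 => /eqP cz.
have : spectrum A (c%:C)%C.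
  apply/spectrumP; exists z, 0; split => /=.
  - by apply: contra z0 => /eqP[->].
  - by rewrite scale0r subr0 -cz.
  - by rewrite linear0 scale0r scaler0 addr0.
by move=> /bound/=; rewrite leNgt Ac.
Qed.

End Adjoint.

Theorem theorem2p7 (R : realType) (V : vectType R) (dot : {dot V for idfun})
    (K : set V) (A : 'End(V)) :
  \dim {:V} != 0%N ->
  convex_cone K -> closed_set dot K -> proper_cone K -> generating_cone K ->
  qmi dot K A ->
  spectral_bound A < 0 <->
  exists v : V, interior_set dot (dual_cone dot K) v /\
    (-%R @` interior_set dot (dual_cone dot K)) (adjoint dot A v).
Proof.
move=> V0 Kcone Kcl Kpr Kgen Aqmi.
have AB := adjointP dot A; set B := adjoint dot A in AB *.
have intP := interior_dualP _ Kcone Kcl.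
split=> [tau0|[v [/intP vpos [w /intP wpos wE]]]]; last first.
  have [[l lA <-] _] := spectral_boundP A V0.
  have /spectrumP[x [y [xy0 Bx By]]] := spectrum_adjoint AB lA.
  apply: (adjoint_eigen_lt0 Kcone Kcl Kgen Aqmi AB vpos _ xy0 Bx By) => u Ku u0.
  by rewrite -wE -scaleN1r dotZl mulN1r oppr_lt0 wpos.
have BA y z : dot (B y) z = dot y (A z) by rewrite dotC -AB dotC.
have kerB c : 0 <= c -> lker (c *: \1 - B)%VF == 0%VS.
  move=> c0; apply: spectral_bound_resolvent_ker => //.
  apply: lt_le_trans c0; apply: le_lt_trans tau0.
  have [[l lB <-] _] := spectral_boundP B V0.
  have [_ bound] := spectral_boundP A V0.
  exact: bound (spectrum_adjoint BA lB).
have [e eint] := interior_dual_exists Kcone Kcl Kpr.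
have epos := (intP e).1 eint; have [m m0 mP] := cone_coercive Kcone Kcl epos.
have [M M0 MP] := linear_le_norm dot B.
have Ne0 := dot_norm_ge0 dot e.
(* c1 is large enough for c1 e - B e to be interior: m bounds dot e from below
   and M bounds B from above. *)
pose c1 := (M * dot_norm dot e + 1) / m.
have c10 : 0 <= c1 by rewrite divr_ge0 ?(ltW m0)// addr_ge0// mulr_ge0// ltW.
pose v c := ((c *: \1 - B)^-1)%VF (c1 *: e - B e).
have vE c : 0 <= c -> c *: v c - B (v c) = c1 *: e - B e.
  move=> /kerB kc; rewrite -[RHS](lker0_lfunVK kc).
  by rewrite !(add_lfunE, opp_lfunE, scale_lfunE, id_lfunE).
have wpos u : K u -> u != 0 -> 0 < dot (c1 *: e - B e) u.
  move=> Ku u0; have Nu := dot_norm_gt0 dot u0; rewrite dotBl dotZl.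
  have h1 : (M * dot_norm dot e + 1) * dot_norm dot u <= c1 * dot e u.
    by rewrite /c1 -mulrA ler_wpM2l ?mulr_ge0 ?addr_ge0 ?mulr_ge0 ?(ltW M0)//
      mulrC ler_pdivlMr// mulrC mP.
  have h2 : dot (B e) u <= M * dot_norm dot e * dot_norm dot u.
    rewrite (le_trans (ler_norm _))// (le_trans (ler_abs_dot _ _ _))//.
    by rewrite ler_wpM2r// ltW.
  lra.
have vc1 : v c1 = e.
  rewrite -[RHS](lker0_lfunK (kerB c1 c10)) /v.
  by rewrite !(add_lfunE, opp_lfunE, scale_lfunE, id_lfunE).
have v0K : dual_cone dot K (v 0).
  apply: (resolvent_dual Kcone Kcl Aqmi AB kerB vE wpos c10).
  by rewrite vc1 => u Ku; have [->|u0] := eqVneq u 0; rewrite ?dot0r// ltW// epos.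
have Bv0 : B (v 0) = - (c1 *: e - B e) by rewrite -(vE 0 (lexx _)) scale0r sub0r opprK.
exists (v 0); split; last by rewrite Bv0; exists (c1 *: e - B e) => //; apply/intP.
apply/intP; apply: (resolvent_dual_pos Aqmi AB (c := 0)) v0K; rewrite vE//.
Qed.
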